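(* In the finite-horizon purchasing problem described in the context, the threshold $b(t)$ is monotonically increasing in $t$ for $0<t<T$ ($t$ in the decision grid); that is, $b(t_n)\le b(t_m)$ whenever $0<t_n\le t_m<T$.
   Context: Model. A single item must be purchased within a finite horizon $[0,T]$. Decisions are made on the grid $t_n = n\cdot dt$, $0\le n\le N$, with $dt>0$ and $N=T/dt$. The item's price follows the AR(1) process $X_t = \theta K\,dt + (1-K\,dt)X_{t-dt} + \sigma\varepsilon_t$, where $\theta\in\mathbb{R}$, $\sigma>0$, $|1-K\,dt|<1$, and the $\varepsilon_{t_1},\varepsilon_{t_2},\dots$ are i.i.d. $N(0,dt)$. For $t_n<t_i$, $X_{t_n,t_i}(x)$ denotes the random price $X_{t_i}$ conditioned on $X_{t_n}=x$. Holding the item from $t_n$ to $t_N$ costs $dt\sum_{i=n}^{N-1}h_{t_i}$, where the per-unit-time holding costs $h_{t_0},\dots,h_{t_{N-1}}$ are real numbers that are weakly decreasing in time. Value function. $V(x,t_N)=x$ (the item must be bought at $t_N$ if not bought before), and for $0\le n<N$, $$V(x,t_n)=\min\Big\{V^C(x,t_n),\; x+dt\sum_{i=n}^{N-1}h_{t_i}\Big\},\qquad V^C(x,t_n)=E\big[V(X_{t_n,t_{n+1}}(x),t_{n+1})\big].$$ Threshold. For $0\le n\le N-1$, $b(t_n)$ is the (single) real number with $V^C(b(t_n),t_n)=b(t_n)+dt\sum_{i=n}^{N-1}h_{t_i}$; by convention $b(t_N)=\infty$. *)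

(* Defs.v *)
From HB Require Import structures.
From mathcomp Require Import all_boot all_order all_algebra finmap.
From mathcomp Require Import all_classical all_reals all_analysis.
Set Implicit Arguments.
Unset Strict Implicit.
Unset Printing Implicit Defensive.
Import Order.TTheory GRing.Theory Num.Theory.
Import numFieldNormedType.Exports.
Local Open Scope classical_set_scope.
Local Open Scope ring_scope.

(* Mutual independence of the real random variables (eps i), i in I: the
   product rule for every finite subfamily and all Borel sets. *)
Definition mutually_independent (d : measure_display) (Omega : measurableType d)
    (R : realType) (P : probability Omega R) (I : set nat)
    (eps : nat -> {RV P >-> R}) : Prop :=
  forall (J : {fset nat}) (A : nat -> set R),
    [set` J] `<=` I -> (forall i, measurable (A i)) ->
    P (\bigcap_(i in [set` J]) (eps i @^-1` A i)) =
      (\prod_(i <- J) P (eps i @^-1` A i))%E.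

(* [normal_prob] takes the standard deviation, hence the square root. *)
Definition iid_centered_normal (d : measure_display) (Omega : measurableType d)
    (R : realType) (P : probability Omega R) (I : set nat) (variance : R)
    (eps : nat -> {RV P >-> R}) : Prop :=
  mutually_independent I eps /\
  forall i, I i -> forall A : set R, measurable A ->
    distribution P (eps i) A = normal_prob 0 (Num.sqrt variance) A.

Definition ar1_step (R : realType) (dt K theta sigma x e : R) : R :=
  theta * K * dt + (1 - K * dt) * x + sigma * e.

(* X_{t_n,t_i}(x): the price at t_i when it equals x at t_n, i.e. the
   AR(1) recursion restarted from x at t_n and driven by eps_{n+1}, ..., eps_i.
   For i <= n it is x. *)
Fixpoint price_from (R : realType) (Omega : Type) (dt K theta sigma : R)
    (eps : nat -> Omega -> R) (n : nat) (x : R) (i : nat) (w : Omega) : R :=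
  if i is j.+1 then
    if (i <= n)%N then x
    else ar1_step dt K theta sigma
           (price_from dt K theta sigma eps n x j w) (eps i w)
  else x.

(* Cost of holding the item from t_n to t_N. *)
Definition holding_cost (R : realType) (dt : R) (N : nat) (h : nat -> R)
    (n : nat) : R :=
  dt * \sum_(n <= i < N) h i.

(* The value function at t_{N-k}, by recursion on the number k of remaining
   periods. The expectations are finite, each value function being
   1-Lipschitz in the price, so [fine] loses nothing. *)
Fixpoint value_remaining (d : measure_display) (Omega : measurableType d)
    (R : realType) (P : probability Omega R) (dt K theta sigma : R) (N : nat)
    (h : nat -> R) (eps : nat -> {RV P >-> R}) (k : nat) (x : R) : R :=
  if k is j.+1 then
    Num.min
      (fine 'E_P[fun w => value_remaining dt K theta sigma N h eps j
                   (price_from dt K theta sigma eps (N - k) x (N - j) w)])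
      (x + holding_cost dt N h (N - k))
  else x.

(* V(x, t_n), for n <= N. *)
Definition value (d : measure_display) (Omega : measurableType d)
    (R : realType) (P : probability Omega R) (dt K theta sigma : R) (N : nat)
    (h : nat -> R) (eps : nat -> {RV P >-> R}) (n : nat) (x : R) : R :=
  value_remaining dt K theta sigma N h eps (N - n) x.

(* V^C(x, t_n), for n < N. *)
Definition continuation_value (d : measure_display) (Omega : measurableType d)
    (R : realType) (P : probability Omega R) (dt K theta sigma : R) (N : nat)
    (h : nat -> R) (eps : nat -> {RV P >-> R}) (n : nat) (x : R) : R :=
  fine 'E_P[fun w => value dt K theta sigma N h eps n.+1
                       (price_from dt K theta sigma eps n x n.+1 w)].

Lemma value_terminal (d : measure_display) (Omega : measurableType d)
    (R : realType) (P : probability Omega R) (dt K theta sigma : R) (N : nat)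
    (h : nat -> R) (eps : nat -> {RV P >-> R}) (x : R) :
  value dt K theta sigma N h eps N x = x.
Proof. by rewrite /value subnn. Qed.

Lemma value_bellman (d : measure_display) (Omega : measurableType d)
    (R : realType) (P : probability Omega R) (dt K theta sigma : R) (N : nat)
    (h : nat -> R) (eps : nat -> {RV P >-> R}) (n : nat) (x : R) :
  (n < N)%N ->
  value dt K theta sigma N h eps n x =
    Num.min (continuation_value dt K theta sigma N h eps n x)
            (x + holding_cost dt N h n).
Proof.
move=> nN; rewrite /continuation_value /value.
have E : (N - n)%N = (N - n.+1).+1 by rewrite subnSK.
rewrite {1}E [LHS]/= -E; congr Num.min; last by rewrite subKn // ltnW.
by rewrite !subKn // ltnW.
Qed.

Lemma price_from_start (R : realType) (Omega : Type) (dt K theta sigma : R)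
    (eps : nat -> Omega -> R) (n : nat) (x : R) (w : Omega) :
  price_from dt K theta sigma eps n x n w = x.
Proof. by case: n => [//|n] /=; rewrite ltnSn. Qed.

(* b(t_n) is the solution of V^C(x, t_n) = x + (holding cost from t_n), with
   b(t_N) = +oo. For n < N the equation has exactly one solution when
   |1 - K dt| < 1 and the noise is centered normal, since V^C(., t_n) is then
   |1 - K dt|-Lipschitz; the default value 0 of [xget] is not used. *)
Definition threshold (d : measure_display) (Omega : measurableType d)
    (R : realType) (P : probability Omega R) (dt K theta sigma : R) (N : nat)
    (h : nat -> R) (eps : nat -> {RV P >-> R}) (n : nat) : \bar R :=
  if (n < N)%N then
    (xget 0 [set x : R | continuation_value dt K theta sigma N h eps n x =
                         x + holding_cost dt N h n])%:E
  else +oo%E.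

(* Main.v *)
(* Subtracting the holding cost H_n = dt * sum_(n <= i < N) h_i, the threshold
   b(t_n) is the fixed point of g_n(x) = V^C(x, t_n) - H_n. Backward induction
   shows that every V(., t_n) is 1-Lipschitz (the noise is integrable, and its
   law is the same at all times), so g_n is |1 - K dt|-Lipschitz, hence a
   contraction. Since h decreases, another backward induction gives
   g_n <= g_(n+1): it starts from V(x, t_(N-1)) <= x + dt h_(N-1), and passes
   through the monotone map f |-> E[f(X_(t_n, t_(n+1))(x))] and the minimum in
   the Bellman equation. Fixed points of contractions are monotone in the
   map. *)
Require Import Defs.
From HB Require Import structures.
From mathcomp Require Import all_boot all_order all_algebra.
From mathcomp Require Import all_classical all_reals all_analysis.
From mathcomp Require Import measurable_realfun ring lra zify.
Import Order.TTheory GRing.Theory Num.Theory.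
Import numFieldNormedType.Exports.
Local Open Scope classical_set_scope.
Local Open Scope ring_scope.

(** * First moment of the normal law *)

(** The Radon-Nikodym derivative and [normal_pdf] have the same integral over every measurable set,
    hence agree almost everywhere. *)
Lemma ge0_integral_normal_prob (R : realType) (m s : R)
    (f : R -> \bar R) :
  measurable_fun [set: R] f -> (forall x, 0 <= f x)%E ->
  (\int[normal_prob m s]_x f x =
   \int[lebesgue_measure]_x (f x * (normal_pdf m s x)%:E))%E.
Proof.
move=> mf f0; have dom := @normal_prob_dominates R m s.
rewrite -(Radon_Nikodym_SigmaFinite.change_of_variables dom)//.
have ig := Radon_Nikodym_SigmaFinite.f_integrable dom.
have mpdf : measurable_fun [set: R] (fun x => (normal_pdf m s x)%:E).
  by apply/measurable_EFinP; exact: measurable_normal_pdf.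
apply: ae_eq_integral => //.
- by apply: emeasurable_funM => //; exact: measurable_int ig.
- exact: emeasurable_funM.
- apply: ae_eqe_mul2l; apply: integral_ae_eq => //.
  move=> E _ mE.
  by rewrite -(Radon_Nikodym_SigmaFinite.f_integral dom).
Qed.

(* Doubling the standard deviation absorbs the factor |x|:
   |x| <= 1 + x^2 and x^2 = 8/3 s^2 t <= 8/3 s^2 exp t, where
   t = 3/8 x^2/s^2 is the difference of the two exponents. *)
Lemma abs_normal_fun_le (R : realType) (s x : R) : s != 0 ->
  `|x| * normal_fun 0 s x <=
  (1 + 8 / 3 * s ^+ 2) * normal_fun 0 (2 * s) x.
Proof.
move=> s0; have s2 : 0 < s ^+ 2 by rewrite exprn_even_gt0.
pose t := 3 / 8 * (x ^+ 2 / s ^+ 2).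
have t0 : 0 <= t by rewrite mulr_ge0// divr_ge0 ?sqr_ge0.
have xE : x ^+ 2 = 8 / 3 * s ^+ 2 * t by rewrite /t; field.
have -> : normal_fun 0 (2 * s) x = expR t * normal_fun 0 s x.
  rewrite /normal_fun -expRD subr0 /t; congr expR.
  rewrite !mulr2n; field.
  by rewrite -!mulr2n !mulrn_eq0 !expf_eq0 mulf_eq0 pnatr_eq0 (negbTE s0).
rewrite mulrA ler_wpM2r ?normal_fun_ge0//.
have et : 1 + t <= expR t by exact: expR_ge1Dx.
have nx : `|x| <= 1 + x ^+ 2.
  by rewrite -real_normK ?num_real//; nra.
apply: (le_trans nx); rewrite xE.
have c0 : 0 <= 8 / 3 * s ^+ 2 by rewrite mulr_ge0 ?ltW.
by move: (8 / 3 * s ^+ 2) c0 => c c0; nra.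
Qed.

Lemma integrable_id_normal_prob (R : realType) (s : R) : s != 0 ->
  (normal_prob 0 s).-integrable [set: R] (fun x => x%:E).
Proof.
move=> s0; apply/integrableP; split; first exact/measurable_EFinP.
rewrite ge0_integral_normal_prob//; last first.
  by apply: measurableT_comp => //; exact/measurable_EFinP.
have s20 : 2 * s != 0 by rewrite mulf_neq0.
(* The ratio of peaks turns the bound on [normal_fun] into one between densities, the larger of
   which has integral 1. *)
pose C := normal_peak s * (1 + 8 / 3 * s ^+ 2) / normal_peak (2 * s).
have C0 : 0 <= C.
  rewrite mulr_ge0 ?invr_ge0 ?normal_peak_ge0// mulr_ge0 ?normal_peak_ge0//.
  by rewrite addr_ge0// mulr_ge0// sqr_ge0.
apply: (@le_lt_trans _ _
  (\int[lebesgue_measure]_x (C%:E * (normal_pdf 0 (2 * s) x)%:E))%E).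
  apply: ge0_le_integral => //=.
  - by move=> x _; rewrite mule_ge0// lee_fin normal_pdf_ge0.
  - apply: emeasurable_funM; last first.
      by apply/measurable_EFinP; exact: measurable_normal_pdf.
    by apply: measurableT_comp => //; exact/measurable_EFinP.
  - apply: emeasurable_funM => //.
    by apply/measurable_EFinP; exact: measurable_normal_pdf.
  - move=> x _; rewrite -!EFinM lee_fin !normal_pdfE//.
    rewrite /C [leRHS]mulrA divfK; last by rewrite gt_eqF ?normal_peak_gt0.
    rewrite [leLHS]mulrCA -[leRHS]mulrA ler_wpM2l ?normal_peak_ge0//.
    exact: abs_normal_fun_le.
rewrite ge0_integralZl//=.
- by rewrite integral_normal_pdf mule1 ltry.
- by apply/measurable_EFinP; exact: measurable_normal_pdf.
- by move=> x _; rewrite lee_fin normal_pdf_ge0.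
Qed.

(** * Lipschitz functions of an integrable noise *)

Lemma lipschitz_continuous (R : realType) (L : R) (f : R -> R) :
  (forall x y, `|f x - f y| <= L * `|x - y|) -> continuous f.
Proof.
move=> fL x; apply/cvgrPdist_lt => e e0.
(* Adding 1 allows division even when [L] is 0. *)
have L1 : 0 < `|L| + 1 by rewrite ltr_wpDl.
near=> y; apply: (le_lt_trans (fL _ _)).
apply: (@le_lt_trans _ _ ((`|L| + 1) * `|x - y|)).
  by rewrite ler_wpM2r// (le_trans (ler_norm _))// lerDl.
rewrite -ltr_pdivlMl//; near: y.
have d0 : 0 < (`|L| + 1)^-1 * e by rewrite mulr_gt0 ?invr_gt0.
by move: (`|L| + 1)^-1 d0 => c d0; apply: cvgr_dist_lt => //; exact: cvg_id.
Unshelve. all: by end_near. Qed.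

Lemma lipschitz_measurable (R : realType) (L : R) (f : R -> R) :
  (forall x y, `|f x - f y| <= L * `|x - y|) -> measurable_fun [set: R] f.
Proof.
by move=> /lipschitz_continuous; exact: continuous_measurable_fun.
Qed.

(** Dominated by [|f 0| + |L| * |x|], integrable for a probability with a first moment. *)
Lemma lipschitz_integrable (R : realType)
    (nu : probability (measurableTypeR R) R) (L : R) (f : R -> R) :
  nu.-integrable [set: R] (fun x => x%:E) ->
  (forall x y, `|f x - f y| <= L * `|x - y|) ->
  nu.-integrable [set: R] (EFin \o f).
Proof.
move=> inu fL.
apply: (@le_integrable _ _ _ nu _ measurableT _
  (fun x => (`|f 0|%:E + `|L|%:E * `|x%:E|)%E)).
- by apply/measurable_EFinP; exact: lipschitz_measurable fL.
- move=> x _ /=; rewrite lee_fin.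
  rewrite [leRHS]ger0_norm; last by rewrite addr_ge0 ?mulr_ge0.
  rewrite -lerBlDl (le_trans (lerB_dist _ _))// (le_trans (fL _ _))// subr0.
  by rewrite ler_wpM2r// ler_norm.
- apply: integrableD => //.
    exact: finite_measure_integrable_cst.
  by apply: integrableZl => //; exact: integrable_abse.
Qed.

(** Moves expectations from [Omega] to the law [nu], so that noises of different times can be
    interchanged. *)
Lemma expectation_lipschitz_comp (d : measure_display)
    (Omega : measurableType d) (R : realType) (P : probability Omega R)
    (nu : probability (measurableTypeR R) R) (X : {RV P >-> R}) (L : R)
    (f : R -> R) :
  nu.-integrable [set: R] (fun x => x%:E) ->
  (forall A : set R, measurable A -> distribution P X A = nu A) ->
  (forall x y, `|f x - f y| <= L * `|x - y|) ->
  fine 'E_P[f \o X] = \int[nu]_x f x.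
Proof.
move=> inu Xnu fL; have mf := lipschitz_measurable _ _ _ fL.
have mEf : measurable_fun [set: R] (EFin \o f) by exact/measurable_EFinP.
(* The Borel structures of [R] and of [measurableTypeR R] (on which
   [normal_prob] lives) have the same sets but different displays, so [X] is
   repackaged with codomain [measurableTypeR R]. *)
have mX : measurable_fun [set: Omega] (X : Omega -> measurableTypeR R).
  by move=> _ A mA; exact: (measurable_funP X).
pose X' : {mfun Omega >-> measurableTypeR R} :=
  HB.pack (X : Omega -> measurableTypeR R)
    (isMeasurableFun.Build _ _ _ _ _ mX).
have nuE (g : measurableTypeR R -> \bar R) :
    (\int[nu]_x g x = \int[distribution P X']_x g x)%E.
  by apply: eq_measure_integral => A mA _; exact/esym/Xnu.
rewrite unlock /Rintegral nuE integral_distribution//.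
apply/integrableP; split; first exact: measurableT_comp.
have [_] := integrableP _ _ _ (lipschitz_integrable _ _ _ _ inu fL).
rewrite nuE ge0_integral_distribution//.
exact: measurableT_comp.
Qed.

(** * The one-step AR(1) transition operator *)

Definition ar1_expectation (R : realType)
    (nu : probability (measurableTypeR R) R) (dt K theta sigma : R)
    (f : R -> R) (x : R) : R :=
  \int[nu]_e f (ar1_step dt K theta sigma x e).

Lemma lipschitz_ar1_step (R : realType) (dt K theta sigma x : R) (f : R -> R) :
  (forall y z, `|f y - f z| <= 1 * `|y - z|) ->
  forall e e', `|f (ar1_step dt K theta sigma x e) -
                 f (ar1_step dt K theta sigma x e')| <= `|sigma| * `|e - e'|.
Proof.
move=> fL e e'; apply: (le_trans (fL _ _)).
by rewrite mul1r -normrM mulrBr /ar1_step opprD addrACA subrr add0r.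
Qed.

Lemma integrable_ar1_step (R : realType)
    (nu : probability (measurableTypeR R) R) (dt K theta sigma x : R)
    (f : R -> R) :
  nu.-integrable [set: R] (fun x => x%:E) ->
  (forall y z, `|f y - f z| <= 1 * `|y - z|) ->
  nu.-integrable [set: R] (EFin \o (f \o ar1_step dt K theta sigma x)).
Proof.
move=> inu fL; apply: (@lipschitz_integrable _ _ `|sigma|) => //.
exact: lipschitz_ar1_step.
Qed.

(** Couple both starting prices through the same noise: after one step they differ by exactly
    [(1 - K * dt) * (x - y)]. *)
Lemma ar1_expectation_lipschitz (R : realType)
    (nu : probability (measurableTypeR R) R) (dt K theta sigma : R)
    (f : R -> R) :
  nu.-integrable [set: R] (fun x => x%:E) ->
  (forall y z, `|f y - f z| <= 1 * `|y - z|) ->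
  forall x y, `|ar1_expectation R nu dt K theta sigma f x -
                ar1_expectation R nu dt K theta sigma f y| <=
              `|1 - K * dt| * `|x - y|.
Proof.
move=> inu fL x y.
have ix := integrable_ar1_step _ _ dt K theta sigma x f inu fL.
have iy := integrable_ar1_step _ _ dt K theta sigma y f inu fL.
rewrite -RintegralB//.
have iB : nu.-integrable [set: R] (EFin \o (fun e =>
    f (ar1_step dt K theta sigma x e) - f (ar1_step dt K theta sigma y e))).
  by apply: eq_integrable (integrableB _ ix iy).
apply: (le_trans (le_normr_Rintegral _ iB)) => //.
apply: (@le_trans _ _ (\int[nu]_e (`|1 - K * dt| * `|x - y|))).
  apply: le_Rintegral => //.
  - exact: integrable_abse iB.
  - exact: finite_measure_integrable_cst.
  - move=> e _; apply: (le_trans (fL _ _)); rewrite mul1r -normrM /ar1_step.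
    by rewrite le_eqVlt; apply/orP; left; apply/eqP; congr `|_|; ring.
by rewrite Rintegral_cst//= probability_setT mulr1.
Qed.

(** Monotonicity of the operator; [c], later a one-period holding cost, passes through since [nu]
    has mass 1. *)
Lemma ar1_expectation_le_addr (R : realType)
    (nu : probability (measurableTypeR R) R) (dt K theta sigma c : R)
    (f g : R -> R) :
  nu.-integrable [set: R] (fun x => x%:E) ->
  (forall y z, `|f y - f z| <= 1 * `|y - z|) ->
  (forall y z, `|g y - g z| <= 1 * `|y - z|) ->
  (forall y, f y <= g y + c) ->
  forall x, ar1_expectation R nu dt K theta sigma f x <=
            ar1_expectation R nu dt K theta sigma g x + c.
Proof.
move=> inu fL gL fg x.
have ig := integrable_ar1_step _ _ dt K theta sigma x g inu gL.
have ic : nu.-integrable [set: R] (EFin \o cst c).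
  exact: finite_measure_integrable_cst.
have -> : ar1_expectation R nu dt K theta sigma g x + c =
    \int[nu]_e (g (ar1_step dt K theta sigma x e) + c).
  by rewrite RintegralD// Rintegral_cst//= probability_setT mulr1.
apply: le_Rintegral => //; first exact: integrable_ar1_step.
by apply: eq_integrable (integrableD _ ig ic).
Qed.

(** * Minima, holding costs and fixed points *)

Lemma min_lipschitz (R : realType) (f g : R -> R) :
  (forall x y, `|f x - f y| <= 1 * `|x - y|) ->
  (forall x y, `|g x - g y| <= 1 * `|x - y|) ->
  forall x y, `|Num.min (f x) (g x) - Num.min (f y) (g y)| <= 1 * `|x - y|.
Proof.
move=> fL gL x y; move: (fL x y) (gL x y); rewrite !ler_norml.
move=> /andP[f1 f2] /andP[g1 g2]; apply/andP.
by case: (lerP (f x)); case: (lerP (f y)); split; lra.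
Qed.

Lemma holding_cost_recl (R : realType) (dt : R) (N : nat) (h : nat -> R)
    (n : nat) : (n < N)%N ->
  holding_cost dt N h n = dt * h n + holding_cost dt N h n.+1.
Proof. by move=> nN; rewrite /holding_cost big_ltn// mulrDr. Qed.

Lemma contraction_fixed_point (R : realType) (L : R) (g : R -> R) :
  L < 1 -> (forall x y, `|g x - g y| <= L * `|x - y|) ->
  exists x, g x = x.
Proof.
move=> L1 gL.
pose g' : {fun [set: R] >-> [set: R]} :=
  HB.pack g (isFun.Build _ _ [set: R] [set: R] g (fun _ _ => I)).
have L0 : 0 <= L by have := gL 1 0; rewrite subr0 normr1 mulr1; exact: le_trans.
have [||p _ pE] := @banach_fixed_point R R^o [set: R] g' _ closedT.
- exists (NngNum L0); split => // -[x y] _ /=; exact: gL.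
- by exists 0.
by exists p.
Qed.

(** If [b < a], then [a - b = f a - g b <= g a - g b <= L * (a - b) < a - b]. *)
Lemma fixed_point_le (R : realType) (L a b : R) (f g : R -> R) :
  L < 1 -> (forall x y, `|g x - g y| <= L * `|x - y|) ->
  (forall x, f x <= g x) -> f a = a -> g b = b -> a <= b.
Proof.
move=> L1 gL fg fa gb; rewrite leNgt; apply/negP => ba.
have : a - b <= L * `|a - b|.
  apply: le_trans (gL a b); rewrite (le_trans _ (ler_norm _))// lerB// ?gb//.
  by rewrite -{1}fa.
by rewrite gtr0_norm ?subr_gt0//; nra.
Qed.

(** * Backward induction on values, then thresholds *)

Section purchasing.
Context (d : measure_display) (Omega : measurableType d) (R : realType)
    (P : probability Omega R) (nu : probability (measurableTypeR R) R)
    (dt K theta sigma : R) (N : nat) (h : nat -> R) (eps : nat -> {RV P >-> R})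
    (inu : nu.-integrable [set: R] (fun x => x%:E))
    (contracting : `|1 - K * dt| < 1)
    (eps_law : forall i, (0 < i <= N)%N -> forall A : set R, measurable A ->
       distribution P (eps i) A = nu A).

Local Notation V := (value dt K theta sigma N h eps).
Local Notation VC := (continuation_value dt K theta sigma N h eps).
Local Notation H := (holding_cost dt N h).
Local Notation E := (ar1_expectation R nu dt K theta sigma).

Lemma continuation_valueE (n : nat) : (n < N)%N ->
  (forall x y, `|V n.+1 x - V n.+1 y| <= 1 * `|x - y|) ->
  forall x, VC n x = E (V n.+1) x.
Proof.
move=> nN VL x; rewrite /continuation_value /ar1_expectation.
rewrite -(@expectation_lipschitz_comp _ _ _ P nu (eps n.+1) `|sigma|
  (V n.+1 \o ar1_step dt K theta sigma x))//.
- congr (fine 'E_P[_]); apply/funext => w /=.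
  by rewrite ltnn price_from_start.
- exact: eps_law.
- exact: lipschitz_ar1_step.
Qed.

Lemma value_lipschitz (n : nat) : (n <= N)%N ->
  forall x y, `|V n x - V n y| <= 1 * `|x - y|.
Proof.
(* Induction on the number [k] of remaining periods, with [n] generalized. *)
move: {2}(N - n)%N (erefl (N - n)%N) => k.
elim: k n => [|k IH] n nE nN.
  have -> : n = N by lia.
  by move=> x y; rewrite !value_terminal mul1r.
have nN1 : (n < N)%N by lia.
have VL := IH n.+1 ltac:(lia) nN1.
move=> x y; rewrite !value_bellman//.
apply: (min_lipschitz _ (VC n) (fun z => z + H n)) => {}x {}y.
  rewrite !continuation_valueE//.
  apply: (le_trans (ar1_expectation_lipschitz _ _ _ _ _ _ _ inu VL _ _)).
  by rewrite ler_wpM2r// ltW.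
by rewrite opprD addrACA subrr addr0 mul1r.
Qed.

Lemma continuation_value_lipschitz (n : nat) : (n < N)%N ->
  forall x y, `|VC n x - VC n y| <= `|1 - K * dt| * `|x - y|.
Proof.
move=> nN x y; have VL := @value_lipschitz n.+1 nN.
by rewrite !continuation_valueE//; exact: ar1_expectation_lipschitz.
Qed.

(** As [H n - H n.+1 = dt * h n], this compares the maps [VC n - H n] and [VC n.+1 - H n.+1], in a
    form that the transition operator preserves. *)
Lemma continuation_value_le_succ (n : nat) :
  (forall i j : nat, (i <= j)%N -> (j < N)%N -> h j <= h i) ->
  0 <= dt -> (n.+1 < N)%N ->
  forall x, VC n x <= VC n.+1 x + dt * h n.
Proof.
move=> h_decr dt0.
move: {2}(N - n.+2)%N (erefl (N - n.+2)%N) => k.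
elim: k n => [|k IH] n kE nN x; have nN1 := ltnW nN;
    rewrite !continuation_valueE//; try exact: value_lipschitz.
  (* Base case: buying at once bounds [V n.+1 y] by [y + dt * h n.+1], while [V n.+2 y] is the
     terminal value [y]. *)
  have NE : N = n.+2 by lia.
  apply: (@ar1_expectation_le_addr) => //; try exact: value_lipschitz.
  move=> y.
  have -> : V n.+2 y = y by rewrite -NE value_terminal.
  rewrite value_bellman// ge_min holding_cost_recl// -NE.
  rewrite [H N]/holding_cost big_geq// mulr0 addr0 lerD2l.
  by rewrite ler_wpM2l ?h_decr// orbT.
have nN2 : (n.+2 < N)%N by lia.
apply: (@ar1_expectation_le_addr) => //; try exact: value_lipschitz.
(* From [n.+2] to [n.+1], each branch of the Bellman minimum grows by at most [dt * h n.+1], hence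
   by at most [dt * h n]. *)
move=> y; have hle : dt * h n.+1 <= dt * h n by rewrite ler_wpM2l ?h_decr.
have := IH n.+1 ltac:(lia) nN2 y.
rewrite !value_bellman// (@holding_cost_recl _ _ _ _ n.+1)//.
move: (VC n.+1 y) (VC n.+2 y) (H n.+2) => a b c ab.
by case: (lerP a); case: (lerP b); lra.
Qed.

Lemma thresholdP (n : nat) : (n < N)%N ->
  exists2 b, threshold dt K theta sigma N h eps n = b%:E &
             VC n b - H n = b.
Proof.
move=> nN; rewrite /threshold nN; eexists; first by [].
have [x xE] : exists x, VC n x - H n = x.
  apply: (@contraction_fixed_point _ `|1 - K * dt|) => // x y.
  by rewrite opprD addrACA subrr addr0; exact: continuation_value_lipschitz.
(* The fixed point just found rules out the default branch of [xget]. *)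
case: xgetP => [y _ /= ->|/(_ x)/=]; first by rewrite addrK.
by case; rewrite -{2}xE subrK.
Qed.

Lemma threshold_le_succ (n : nat) :
  (forall i j : nat, (i <= j)%N -> (j < N)%N -> h j <= h i) ->
  0 <= dt -> (n.+1 < N)%N ->
  (threshold dt K theta sigma N h eps n <=
   threshold dt K theta sigma N h eps n.+1)%E.
Proof.
move=> h_decr dt0 nN.
have [a -> aE] := thresholdP _ (ltnW nN); have [b -> bE] := thresholdP _ nN.
rewrite lee_fin.
apply: (fixed_point_le _ `|1 - K * dt| _ _ (fun x => VC n x - H n)
  (fun x => VC n.+1 x - H n.+1)) => // [x y|x].
  by rewrite opprD addrACA subrr addr0; exact: continuation_value_lipschitz.
rewrite (@holding_cost_recl _ _ _ _ n) ?(ltnW nN)//.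
have := continuation_value_le_succ _ h_decr dt0 nN x.
by lra.
Qed.
End purchasing.

Theorem lemma3 (d : measure_display) (Omega : measurableType d) (R : realType)
    (P : probability Omega R) (T dt K theta sigma : R) (N : nat)
    (h : nat -> R) (eps : nat -> {RV P >-> R})
    (dt_gt0 : 0 < dt) (NE : N%:R = T / dt)
    (sigma_gt0 : 0 < sigma) (contracting : `|1 - K * dt| < 1)
    (h_decreasing : forall i j : nat, (i <= j)%N -> (j < N)%N -> h j <= h i)
    (eps_iid : iid_centered_normal [set i | (0 < i <= N)%N] dt eps)
    (n m : nat) :
  0 < n%:R * dt -> n%:R * dt <= m%:R * dt -> m%:R * dt < T ->
  (threshold dt K theta sigma N h eps n <=
   threshold dt K theta sigma N h eps m)%E.
Proof.
(* Dividing by [dt] turns the times into indices [n <= m < N]. *)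
move=> _; rewrite ler_pM2r// ler_nat -ltr_pdivlMr// -NE ltr_nat => nm mN.
have [_ eps_law] := eps_iid.
have inu := @integrable_id_normal_prob R (Num.sqrt dt)
  (lt0r_neq0 (etrans (sqrtr_gt0 dt) dt_gt0)).
(* Consecutive comparisons are chained from [n] up to [m]. *)
elim: m nm mN => [|m IH]; first by rewrite leqn0 => /eqP ->.
rewrite leq_eqVlt => /predU1P[->//|nm mN].
apply: (le_trans (IH nm (ltnW mN))).
apply: (threshold_le_succ _ _ _ _ (normal_prob 0 (Num.sqrt dt))) => //.
exact: ltW.
Qed.
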